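(* Let $q\geq3$ be an odd prime power. Write $D_q^{\square}$ and $D_q^{\not\square}$ for the numbers of ordered triples in $\mathcal D$ whose splitting class is a square, respectively a nonsquare. Then $$D_q^{\square}=\tfrac12\,q(q-1)(q-2)^2(q-3),\qquad D_q^{\not\square}=\tfrac12\,q^2(q-1)^2(q-2),$$ and $D_q^{\square}+D_q^{\not\square}=D_q:=\#\mathcal D$. In particular $$\frac{D_q^{\not\square}}{D_q}=\frac{q(q-1)}{2(q^2-3q+3)}=\frac12+\frac1q+O(q^{-2}),$$ so the two cases occur in asymptotically equal proportions; and every triple in $\mathcal D$ with nontrivial stabiliser in $\operatorname{Aff}(\mathbb F_q)$ (equivalently, every triple in $\mathcal D$ with $u_1=v_1=w_1$) has splitting class a square.
   Context: For $u=x^2+u_1x+u_0$, $v=x^2+v_1x+v_0$, $w=x^2+w_1x+w_0$ in $\mathbb F_q[x]$, let $\mathfrak d(u,v,w)$ be the determinant of the matrix with rows $(u_0,u_1,1),(v_0,v_1,1),(w_0,w_1,1)$. $\mathcal D$ is the set of ordered triples of separable, pairwise coprime monic quadratics over $\mathbb F_q$ with $\mathfrak d=0$. For such a triple the splitting class is the class of $\operatorname{Res}(u,v)$ in $\mathbb F_q^\times/(\mathbb F_q^\times)^2$, which is the same for all three pairs. $\operatorname{Aff}(\mathbb F_q)$ is the group of maps $\alpha: x\mapsto ax+b$ ($a\in\mathbb F_q^\times$, $b\in\mathbb F_q$), acting on monic quadratics by $s\mapsto a^{-2}s(ax+b)$ and componentwise on triples. *)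

(* Defs.v *)
From HB Require Import structures.
From mathcomp Require Import all_boot all_order all_algebra all_field.
From mathcomp Require Import ring.

Set Implicit Arguments.
Unset Strict Implicit.
Unset Printing Implicit Defensive.

Import Order.TTheory GRing.Theory Num.Theory.
Local Open Scope ring_scope.

Section Quadratics.

Variable F : finFieldType.

(* The pair (s0, s1) stands for the monic quadratic x^2 + s1 x + s0. *)
Definition quad_coef : predArgType := (F * F)%type.

Definition quad (s : quad_coef) : {poly F} := 'X^2 + s.2 *: 'X + s.1%:P.

Definition quad_triple : predArgType :=
  (quad_coef * quad_coef * quad_coef)%type.

Definition frakd (u v w : quad_coef) : F :=
  \det (\matrix_(i < 3, j < 3)
    nth 0 (nth [::] [:: [:: u.1; u.2; 1];
                        [:: v.1; v.2; 1];
                        [:: w.1; w.2; 1]] i) j).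

Definition calD : {set quad_triple} :=
  [set t : quad_triple | let: (u, v, w) := t in
    [&& separable_poly (quad u), separable_poly (quad v),
        separable_poly (quad w),
        coprimep (quad u) (quad v), coprimep (quad u) (quad w),
        coprimep (quad v) (quad w) & frakd u v w == 0]].

(* For r != 0, the class of r in F^* / (F^* )^2, as a coset of (F^* )^2. *)
Definition sqclass (r : F) : {set F} :=
  [set r * y ^+ 2 | y : F & y != 0].

(* By splitting_class_pairs below, any two components of a triple in calD
   define the same class. *)
Definition splitting_class (t : quad_triple) : {set F} :=
  let: (u, v, _) := t in sqclass (resultant (quad u) (quad v)).

Definition splitting_square (t : quad_triple) : bool :=
  splitting_class t == sqclass 1.

Definition D_all : nat := #|calD|.
Definition D_square : nat := #|[set t in calD | splitting_square t]|.
Definition D_nonsquare : nat := #|[set t in calD | ~~ splitting_square t]|.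

(* The pair (a, b) with a != 0 stands for the affine map x |-> a x + b. *)
Definition Aff : {set F * F} := [set al : F * F | al.1 != 0].

Definition aff_id : F * F := (1, 0).

Definition aff_act (al : F * F) (s : {poly F}) : {poly F} :=
  al.1 ^- 2 *: (s \Po (al.1 *: 'X + al.2%:P)).

Definition aff_stab (t : quad_triple) : {set F * F} :=
  let: (u, v, w) := t in
  [set al in Aff | [&& aff_act al (quad u) == quad u,
                       aff_act al (quad v) == quad v &
                       aff_act al (quad w) == quad w]].

Definition nontrivial_stab (t : quad_triple) : bool :=
  aff_stab t != [set aff_id].

End Quadratics.

Section SplittingClass.

Variable F : finFieldType.
Implicit Types u v w : quad_coef F.

Lemma size_quad u : size (quad u) = 3.
Proof.
rewrite /quad -addrA size_polyDl size_polyXn //.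
rewrite (leq_ltn_trans (size_polyD _ _)) // gtn_max.
rewrite (leq_ltn_trans (size_scale_leq _ _)) ?size_polyX //=.
by rewrite (leq_ltn_trans (size_polyC_leq1 _)).
Qed.

Lemma coef_quad u (i : nat) :
  (quad u)`_i = nth 0 [:: u.1; u.2; 1] i.
Proof.
rewrite /quad !coefD coefXn coefZ coefX coefC.
by case: i => [|[|[|[|i]]]] //=; rewrite ?mulr0 ?mulr1 ?addr0 ?add0r.
Qed.

Lemma resultant_quad u v :
  resultant (quad u) (quad v) =
  (u.1 - v.1) ^+ 2 + (u.2 - v.2) * (u.2 * v.1 - u.1 * v.2).
Proof.
have [eu ev] : ((size (quad u)).-1 = 2)%N /\ ((size (quad v)).-1 = 2)%N.
  by rewrite !size_quad.
have det_cast n m (e : n = m) (A : 'M[F]_n) : \det (castmx (e, e) A) = \det A.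
  by case: m / e; rewrite castmx_id.
have e : ((size (quad v)).-1 + (size (quad u)).-1 = 4)%N by rewrite eu ev.
rewrite /resultant -(det_cast _ _ e).
pose r1 : seq F := [:: u.1; u.2; 1; 0].
pose r2 : seq F := [:: 0; u.1; u.2; 1].
pose r3 : seq F := [:: v.1; v.2; 1; 0].
pose r4 : seq F := [:: 0; v.1; v.2; 1].
have -> : castmx (e, e) (Sylvester_mx (quad u) (quad v)) =
    \matrix_(i, j) nth 0 (nth [::] [:: r1; r2; r3; r4] i) j.
  apply/matrixP=> i j; rewrite castmxE Sylvester_mxE mxE.
  case: splitP => k /= ik; rewrite !coef_quad.
    have := ltn_ord k; rewrite {2}ev => k2.
    rewrite ik; case: (nat_of_ord k) k2 => [|[|//]] _;
    by case: j => [[|[|[|[|j]]]] lj].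
  have := ltn_ord k; rewrite {2}eu => k2.
  rewrite ik ev; case: (nat_of_ord k) k2 => [|[|//]] _;
  by case: j => [[|[|[|[|j]]]] lj].
do 3!rewrite ?(expand_det_row _ ord0) ?big_ord_recl ?big_ord0 /cofactor.
rewrite ?det_mx11 ?mxE /=.
rewrite /bump /=.
by ring.
Qed.

Lemma frakdE u v w :
  frakd u v w = (v.1 - u.1) * (w.2 - u.2) - (v.2 - u.2) * (w.1 - u.1).
Proof.
rewrite /frakd.
do 2!rewrite ?(expand_det_row _ ord0) ?big_ord_recl ?big_ord0 /cofactor.
rewrite ?det_mx11 ?mxE /= /bump /=.
by ring.
Qed.

Lemma sqclassM (r y : F) : y != 0 -> sqclass (r * y ^+ 2) = sqclass r.
Proof.
move=> y0; apply/setP=> x; apply/imsetP/imsetP => -[z /[!inE] z0 ->].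
  exists (y * z); last by ring.
  by rewrite inE mulf_neq0.
exists (z / y); first by rewrite inE mulf_neq0 ?invr_neq0.
by field.
Qed.

Lemma sqclass_collinear u v w : u != v -> u != w -> frakd u v w = 0 ->
  sqclass (resultant (quad u) (quad v)) = sqclass (resultant (quad u) (quad w)).
Proof.
case: u v w => [u0 u1] [v0 v1] [w0 w1]; rewrite frakdE !resultant_quad /=.
move=> uv uw d0.
suff [t [t0 [e0 e1]]] : exists t, t != 0 /\
    w0 = u0 + t * (v0 - u0) /\ w1 = u1 + t * (v1 - u1).
  rewrite -[LHS](@sqclassM _ t) //; congr sqclass; rewrite e0 e1; ring.
suff [t [e0 e1]] : exists t,
    w0 = u0 + t * (v0 - u0) /\ w1 = u1 + t * (v1 - u1).
  exists t; split=> //; apply: contraNneq uw => t0.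
  by rewrite e0 e1 t0 !mul0r !addr0.
have [e|n0] := eqVneq (v0 - u0) 0; last first.
  exists ((w0 - u0) / (v0 - u0)); split; first by field.
  apply: (mulfI n0); rewrite mulrDr mulrCA mulrA divfK // -[LHS]subr0 -d0.
  by ring.
have n1 : v1 - u1 != 0.
  apply: contraNneq uv => e1; apply/eqP.
  by rewrite -(subrK u0 v0) -(subrK u1 v1) e e1 !add0r.
exists ((w1 - u1) / (v1 - u1)); split; last by field.
apply: (mulfI n1); rewrite mulrDr mulrCA mulrA divfK // -[LHS]addr0 -d0.
by ring.
Qed.

Lemma splitting_class_pairs u v w : (u, v, w) \in calD F ->
  [/\ splitting_class (u, v, w) = sqclass (resultant (quad u) (quad v)),
      splitting_class (u, v, w) = sqclass (resultant (quad u) (quad w)) &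
      splitting_class (u, v, w) = sqclass (resultant (quad v) (quad w))].
Proof.
have neq (a b : quad_coef F) : coprimep (quad a) (quad b) -> a != b.
  by apply: contraTneq => ->; rewrite coprimepp size_quad.
rewrite inE => /and5P[_ _ _ /neq uv /and3P[/neq uw /neq vw /eqP d0]].
split=> //=; first exact: sqclass_collinear.
have -> : resultant (quad u) (quad v) = resultant (quad v) (quad u).
  by rewrite !resultant_quad; ring.
apply: sqclass_collinear => //; first by rewrite eq_sym.
by move: d0; rewrite !frakdE => /eqP; rewrite -oppr_eq0 => /eqP <-; ring.
Qed.

End SplittingClass.

(* Main.v *)
Require Import Defs.
From mathcomp Require Import all_boot all_order all_algebra all_field.
From mathcomp Require Import ring lra zify.

(** A monic quadratic is a point of the affine plane F x F, and the condition
    d(u, v, w) = 0 says that the three points are collinear; so triples are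
    counted line by line.

    A line on which the linear coefficient u1 varies is a pencil
    { u | u(e) = c }: it consists of the quadratics taking the value c at some
    fixed e.  Its points are (x - (e - s))^2 - (s^2 - c), for s in F
    ([pencil_pt]).  In the parameter s the discriminant is 4 (s^2 - c), and two
    points s, t of the pencil have resultant c (2 (s - t))^2.  Hence admissible
    triples on such a line exist only for c != 0; they are the triples of
    distinct s with s^2 != c, and their splitting class is the class of c.
    There remain q - 2 or q values of s, according as c is a square or not,
    and there are q (q - 1) / 2 lines of each kind ([card_slanted]).

    On a line u1 = m the resultant of two points is (u0 - v0)^2, so the
    splitting class is a square, and exactly one of the q points is
    inseparable ([card_vertical]).  Adding up, with n = (q - 1) / 2 and
    m^_3 = m (m - 1) (m - 2), the square triples number
    q n (q - 2)^_3 + q (q - 1)^_3 and the nonsquare ones q n q^_3.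

    The proportions follow by algebra: the nonsquare proportion differs from
    1/2 + 1/q by (3 q - 6) / (2 q (q^2 - 3 q + 3)), which is at most 3 / q^2.

    An affine map x |-> a x + b fixes a quadratic only if 2 b = (a - 1) u1.
    For a = 1 this forces b = 0; for a != 1 it determines u1, so a nontrivial
    stabiliser forces u1 = v1 = w1.  Conversely, the reflection x |-> - x - u1
    fixes every quadratic with linear coefficient u1. *)

Set Implicit Arguments.
Unset Strict Implicit.
Unset Printing Implicit Defensive.

Import Order.TTheory GRing.Theory Num.Theory.
Local Open Scope ring_scope.

(** * Odd finite fields: two, and square roots *)

Lemma odd_card_two_neq0 (F : finFieldType) : odd #|F| -> (2 : F) != 0.
Proof.
move=> oddF; apply/eqP=> two0.
(* Translation by 1 permutes F, so the sum of all elements absorbs #|F| * 1. *)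
have card0 : #|F|%:R = 0 :> F.
  apply: (addrI (\sum_(x : F) x)); rewrite addr0.
  rewrite [RHS](reindex_inj (addIr 1)) /= big_split /=.
  by rewrite sumr_const.
move: card0; rewrite -(odd_double_half #|F|) oddF -muln2 natrD natrM two0.
by rewrite mulr0 addr0 => /eqP; rewrite oner_eq0.
Qed.

Definition is_sqr (F : finFieldType) (c : F) : bool := [exists y, y ^+ 2 == c].

Lemma card_sqrt (F : finFieldType) (c : F) : odd #|F| -> c != 0 ->
  #|[set y : F | y ^+ 2 == c]| = (2 * is_sqr c)%N.
Proof.
move=> /odd_card_two_neq0 two0 c0; rewrite /is_sqr.
have [/existsP[z /eqP zc]|/existsPn nz] :=
  boolP [exists y, y ^+ 2 == c]; last first.
  apply/eqP; rewrite muln0 cards_eq0; apply/eqP/setP=> y.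
  by rewrite !inE; apply/negbTE/nz.
have z0 : z != 0 by apply: contraNneq c0 => z0; rewrite -zc z0 expr0n.
have -> : [set y : F | y ^+ 2 == c] = [set z; - z].
  by apply/setP=> y; rewrite !inE -zc eqf_sqr.
rewrite cards2 eq_sym -subr_eq0.
by have -> : - z - z = - (2 * z) by [ring]; rewrite oppr_eq0 mulf_neq0.
Qed.

Lemma card_not_sqrt (F : finFieldType) (c : F) : odd #|F| -> c != 0 ->
  #|[set s : F | s ^+ 2 != c]| = (#|F| - 2 * is_sqr c)%N.
Proof.
move=> oddF c0; rewrite -(card_sqrt oddF c0) cardsCs; congr (_ - _)%N.
by apply: eq_card => s; rewrite !inE negbK.
Qed.

(** Squaring is two-to-one from the nonzero elements onto the nonzero squares,
    which are therefore half of them. *)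
Lemma card_nonzero_sqr (F : finFieldType) (b : bool) : odd #|F| ->
  #|[set c : F | (c != 0) && (is_sqr c == b)]| = #|F|./2.
Proof.
move=> oddF.
have dec : #|[set c : F | c != 0]| = #|F|.-1.
  by rewrite cardsE -(cardC1 (0 : F)); apply: eq_card.
pose sqs b := [set c : F | (c != 0) && (is_sqr c == b)].
have nsq : (2 * #|sqs true| = #|F|.-1)%N.
  rewrite -dec -[RHS]sum1dep_card.
  rewrite (partition_big (fun y => y ^+ 2)
             (fun c => (c != 0) && (is_sqr c == true))) /=; last first.
    move=> y y0; rewrite expf_eq0 /= y0 /=.
    by apply/eqP/existsP; exists y.
  rewrite -sum1dep_card big_distrr /=; apply: eq_bigr => c /andP[c0 /eqP sc].
  transitivity (2 * is_sqr c)%N; first by rewrite sc.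
  rewrite sum1dep_card -card_sqrt //; apply: eq_card => y.
  rewrite !inE andb_idl // => /eqP yc.
  by apply: contraNneq c0 => y0; rewrite -yc y0 expr0n.
have split : (#|sqs true| + #|sqs false| = #|F|.-1)%N.
  rewrite -dec -(cardsID [set c | is_sqr c] [set c : F | c != 0]).
  congr (_ + _)%N; apply: eq_card => c; rewrite !inE ?eqb_id //.
  by rewrite andbC; case: is_sqr.
rewrite -/(sqs b); case: b; move: nsq split oddF; lia.
Qed.

(** * Counting tools *)

Definition distinct_triples (T : finType) (A : {set T}) : {set T * T * T} :=
  [set t | [&& t.1.1 \in A, t.1.2 \in A, t.2 \in A,
               t.1.1 != t.1.2, t.1.1 != t.2 & t.1.2 != t.2]].

Lemma card_distinct_triples (T : finType) (A : {set T}) :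
  #|distinct_triples A| = #|A| ^_ 3.
Proof.
rewrite -(card_uniq_tuples 3 (mem A)).
pose f (t : T * T * T) := [tuple t.1.1; t.1.2; t.2].
have f_inj : injective f by move=> [[a b] c] [[a' b'] c'] [-> -> ->].
rewrite -(card_imset _ f_inj); apply: eq_card => t; apply/imsetP/idP.
  move=> [[[a b] c]]; rewrite !inE /= => /and5P[aA bA cA ab /andP[ac bc]] ->.
  by rewrite /= !inE negb_or aA bA cA ab ac bc.
case/tupleP: t => a t; case/tupleP: t => b t; case/tupleP: t => c t.
rewrite tuple0 !inE /= !inE negb_or !andbT.
move=> /andP[/and3P[aA bA cA] /andP[/andP[ab ac] bc]].
by exists (a, b, c); [rewrite !inE /= aA bA cA ab ac bc | apply: val_inj].
Qed.

(** Used twice over: for the set of lines, and for the triples on them. *)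
Lemma card_dep_pairs (I T : finType) (P : pred I) (B : I -> {set T}) (k : nat) :
    (forall i, P i -> #|B i| = k) ->
  #|[set p : I * T | P p.1 && (p.2 \in B p.1)]| = (#|[set i | P i]| * k)%N.
Proof.
move=> cardB; transitivity (\sum_(i | P i) \sum_(t in B i) 1)%N.
  by rewrite pair_big_dep sum1dep_card.
rewrite -sum1dep_card big_distrl; apply: eq_bigr => i Pi.
by rewrite sum1_card cardB //= mul1n.
Qed.

(** Valid for all m, as both sides vanish when m < 3.  The factor k keeps the
    falling factorial away from the unfolding of products under the cast. *)
Lemma natr_mul_ffact3 (R : comPzRingType) (k m : nat) :
  (k * m ^_ 3)%:R = k%:R * (m%:R * (m%:R - 1) * (m%:R - 2)) :> R.
Proof.
rewrite natrM; congr (_ * _).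
by case: m => [|[|[|m]]]; rewrite ?ffactnS ?ffactn0 /=; ring.
Qed.

(** * Membership in D in coordinates *)

Definition disc (F : finFieldType) (u : quad_coef F) : F :=
  u.2 ^+ 2 - 4 * u.1.

Definition res (F : finFieldType) (u v : quad_coef F) : F :=
  (u.1 - v.1) ^+ 2 + (u.2 - v.2) * (u.2 * v.1 - u.1 * v.2).

(** If the discriminant vanishes, - u1 / 2 is a common root of u and u'. *)
Lemma separable_quadE (F : finFieldType) (u : quad_coef F) : odd #|F| ->
  separable_poly (quad u) = (disc u != 0).
Proof.
move=> /odd_card_two_neq0 two0.
have dE : (quad u)^`() = 2%:P * 'X + u.2%:P.
  rewrite /quad !derivD derivXn derivZ derivX derivC addr0 /= alg_polyC.
  by rewrite mul_polyC scaler_nat.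
rewrite unlock dE; apply/idP/idP => [cop|d0].
  apply/eqP=> d0.
  have rt : root (quad u) (- (u.2 / 2)).
    rewrite /root /quad !hornerE -(mulrI_eq0 _ (mulfI (mulf_neq0 two0 two0))).
    by rewrite -oppr_eq0 -d0 /disc; apply/eqP; field.
  move: cop => /coprimep_root/(_ rt); rewrite !hornerE.
  by have -> : 2 * - (u.2 / 2) + u.2 = 0 by [field]; rewrite eqxx.
apply/Bezout_coprimepP.
(* Completing the square: (2 x + u1)^2 - 4 u(x) is the discriminant. *)
exists (- 4%:P, 2%:P * 'X + u.2%:P); rewrite /=.
have -> : - 4%:P * quad u + (2%:P * 'X + u.2%:P) * (2%:P * 'X + u.2%:P)
    = (disc u)%:P.
  rewrite /quad /disc -mul_polyC !(polyCB, polyCM, polyC_exp).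
  have -> : 4%:P = 2%:P * 2%:P :> {poly F}.
    by rewrite -polyCM; congr _%:P; ring.
  by ring.
by rewrite polyC_eqp1.
Qed.

Lemma coprime_quadE (F : finFieldType) (u v : quad_coef F) :
  coprimep (quad u) (quad v) = (res u v != 0).
Proof.
have g0 : gcdp (quad u) (quad v) != 0.
  by rewrite gcdp_eq0 -size_poly_eq0 size_quad.
rewrite /res -resultant_quad resultant_eq0 coprimep_def.
by move: g0; rewrite -size_poly_gt0; case: size => [|[|n]].
Qed.

Lemma mem_calD (F : finFieldType) (u v w : quad_coef F) : odd #|F| ->
  ((u, v, w) \in calD F) =
  [&& disc u != 0, disc v != 0, disc w != 0,
      res u v != 0, res u w != 0, res v w != 0 & frakd u v w == 0].
Proof. by move=> oddF; rewrite inE !separable_quadE // !coprime_quadE. Qed.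

Lemma splitting_squareE (F : finFieldType) (u v w : quad_coef F) :
  splitting_square (u, v, w) = [exists y, (y != 0) && (y ^+ 2 == res u v)].
Proof.
rewrite /splitting_square /= resultant_quad -/(res u v).
apply/eqP/existsP => [cls|[y /andP[y0 /eqP yr]]]; last first.
  by rewrite -yr -[y ^+ 2]mul1r sqclassM.
have : res u v \in sqclass 1.
  rewrite -cls; apply/imsetP; exists 1; rewrite ?inE ?oner_eq0 //.
  by rewrite expr1n mulr1.
move=> /imsetP[y]; rewrite inE mul1r => y0 ->.
by exists y; rewrite y0 eqxx.
Qed.

(** * Triples on slanted lines *)

(** The quadratic (x - (e - s))^2 - (s^2 - c), whose value at e is c.  The
    parameter s is half its derivative at e, which makes the discriminant
    4 (s^2 - c) independent of e. *)
Definition pencil_pt (F : finFieldType) (e c s : F) : quad_coef F :=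
  (c + e ^+ 2 - 2 * e * s, 2 * (s - e)).

Lemma disc_pencil_pt (F : finFieldType) (e c s : F) :
  disc (pencil_pt e c s) = 2 ^+ 2 * (s ^+ 2 - c).
Proof. by rewrite /disc /=; ring. Qed.

Lemma res_pencil_pt (F : finFieldType) (e c s t : F) :
  res (pencil_pt e c s) (pencil_pt e c t) = c * (2 * (s - t)) ^+ 2.
Proof. by rewrite /res /=; ring. Qed.

Lemma frakd_pencil_pt (F : finFieldType) (e c s t r : F) :
  frakd (pencil_pt e c s) (pencil_pt e c t) (pencil_pt e c r) = 0.
Proof. by rewrite frakdE /=; ring. Qed.

Lemma pencil_ptP (F : finFieldType) (e c : F) (u : quad_coef F) :
    (2 : F) != 0 -> u.1 + e * u.2 + e ^+ 2 = c ->
  u = pencil_pt e c (u.2 / 2 + e).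
Proof.
by case: u => u0 u1 two0 /= <-; rewrite /pencil_pt; congr (_, _); field.
Qed.

(** If e is the negative slope (u0 - v0) / (u1 - v1), then e is the abscissa at
    which u and v take the same value; evaluation at e is an affine function of
    the coefficients, so every point of the line through u and v has this
    value too. *)
Lemma collinear_pencil (F : finFieldType) (u v w : quad_coef F) :
    (2 : F) != 0 -> u.2 != v.2 -> frakd u v w = 0 ->
  exists e c s t r,
    [/\ u = pencil_pt e c s, v = pencil_pt e c t & w = pencil_pt e c r].
Proof.
move=> two0 uv; rewrite frakdE => d0.
have uv0 : u.2 - v.2 != 0 by rewrite subr_eq0.
pose e := - ((u.1 - v.1) / (u.2 - v.2)).
exists e, (u.1 + e * u.2 + e ^+ 2).
exists (u.2 / 2 + e), (v.2 / 2 + e), (w.2 / 2 + e).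
split; apply: pencil_ptP => //; rewrite -/e; first by rewrite /e; field.
apply: (mulfI uv0); apply/eqP; rewrite -subr_eq0 -d0; apply/eqP.
by rewrite /e; field.
Qed.

Definition slanted_triple (F : finFieldType) (p : F * F * (F * F * F)) :
    quad_triple F :=
  (pencil_pt p.1.1 p.1.2 p.2.1.1, pencil_pt p.1.1 p.1.2 p.2.1.2,
   pencil_pt p.1.1 p.1.2 p.2.2).

(** The first two points already determine the pencil: differences of their
    two coordinates are -2 e (s - t) and 2 (s - t). *)
Lemma slanted_triple_inj (F : finFieldType) (e c s t r e' c' s' t' r' : F) :
    (2 : F) != 0 -> s != t ->
    slanted_triple (e, c, (s, t, r)) = slanted_triple (e', c', (s', t', r')) ->
  (e, c, (s, t, r)) = (e', c', (s', t', r')).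
Proof.
move=> two0 st [us ss ut tt _ rr].
have twoI := mulfI two0.
have {}ss : s = s' - e' + e by rewrite -(twoI _ _ ss) subrK.
have {}tt : t = t' - e' + e by rewrite -(twoI _ _ tt) subrK.
have {}rr : r = r' - e' + e by rewrite -(twoI _ _ rr) subrK.
have ee : e = e'.
  have st0 : 2 * (s - t) != 0 by rewrite mulf_neq0 // subr_eq0.
  apply/(mulfI st0)/eqP; rewrite -subr_eq0; apply/eqP.
  rewrite [LHS](_ : _ = (c + e ^+ 2 - 2 * e * t) - (c + e ^+ 2 - 2 * e * s)
                  - 2 * (s - t) * e'); last by ring.
  by rewrite us ut ss tt; ring.
by move: us; rewrite ss tt rr ee !subrK => /addIr/addIr ->.
Qed.

Lemma mem_calD_slanted (F : finFieldType) (e c s t r : F) : odd #|F| ->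
  (slanted_triple (e, c, (s, t, r)) \in calD F) =
  (c != 0) && ((s, t, r) \in distinct_triples [set x | x ^+ 2 != c]).
Proof.
move=> oddF; have two0 := odd_card_two_neq0 oddF.
rewrite mem_calD // !disc_pencil_pt !res_pencil_pt frakd_pencil_pt eqxx andbT.
rewrite !inE /= !(mulf_eq0, expf_eq0) /= !(negbTE two0) /= !subr_eq0 !negb_or.
by case: (c == 0); rewrite ?andbF ?andbT /= ?andbb ?andbA.
Qed.

Lemma exists_sqrt_mul_sqr (F : finFieldType) (c z : F) : c != 0 -> z != 0 ->
  [exists y, (y != 0) && (y ^+ 2 == c * z ^+ 2)] = is_sqr c.
Proof.
move=> c0 z0; apply/existsP/existsP=> [[y /andP[y0 /eqP yc]]|[y /eqP yc]].
  by exists (y / z); rewrite expr_div_n yc mulfK ?expf_neq0.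
exists (y * z); rewrite mulf_neq0 //=; first by rewrite exprMn yc.
by apply: contraNneq c0 => y0; rewrite -yc y0 expr0n.
Qed.

Lemma splitting_square_slanted (F : finFieldType) (e c s t r : F) :
    (2 : F) != 0 -> c != 0 -> s != t ->
  splitting_square (slanted_triple (e, c, (s, t, r))) = is_sqr c.
Proof.
move=> two0 c0 st; rewrite splitting_squareE res_pencil_pt /=.
by rewrite exists_sqrt_mul_sqr // mulf_neq0 // subr_eq0.
Qed.

Lemma card_slanted (F : finFieldType) (b : bool) : odd #|F| ->
  #|[set t in calD F | (splitting_square t == b) && (t.1.1.2 != t.1.2.2)]| =
  (#|F| * #|F|./2 * (#|F| - 2 * b) ^_ 3)%N.
Proof.
move=> oddF; have two0 := odd_card_two_neq0 oddF.
pose sqs := [set c : F | (c != 0) && (is_sqr c == b)].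
pose lines := [set l : F * F | predT l.1 && (l.2 \in sqs)].
pose pts (l : F * F) := distinct_triples [set x | x ^+ 2 != l.2].
have card_lines : #|lines| = (#|F| * #|F|./2)%N.
  rewrite (@card_dep_pairs _ _ predT (fun=> sqs) _
             (fun _ _ => card_nonzero_sqr b oddF)).
  by congr (_ * _)%N; apply: eq_card => e; rewrite inE.
have card_pts l : l \in lines -> #|pts l| = ((#|F| - 2 * b) ^_ 3)%N.
  rewrite !inE /= => /andP[c0 /eqP sc].
  by rewrite card_distinct_triples card_not_sqrt // sc.
pose dom := [set p : F * F * (F * F * F) |
  (p.1 \in lines) && (p.2 \in pts p.1)].
have <- : #|dom| = (#|F| * #|F|./2 * (#|F| - 2 * b) ^_ 3)%N.
  rewrite -card_lines -(cardsE (mem lines)).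
  exact: (card_dep_pairs (P := mem lines)).
rewrite -(@card_in_imset _ _ (@slanted_triple F) dom); last first.
  move=> [[e c] [[s t] r]] [[e' c'] [[s' t'] r']].
  rewrite !inE => /andP[_ /and5P[_ _ _ st _]] _; exact: slanted_triple_inj.
apply: eq_card => [[[u v] w]]; apply/idP/imsetP.
  rewrite inE => /and3P[tD /eqP sq /= uv].
  have := tD; rewrite mem_calD // => /and5P[_ _ _ _ /and3P[_ _ /eqP d0]].
  have [e [c [s [t [r [eu ev ew]]]]]] := collinear_pencil two0 uv d0.
  have tE : (u, v, w) = slanted_triple (e, c, (s, t, r)) by rewrite eu ev ew.
  exists (e, c, (s, t, r)) => //; rewrite tE in sq tD.
  move: tD; rewrite mem_calD_slanted // => /andP[c0 mst].
  have st : s != t by move: mst; rewrite inE => /and5P[].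
  rewrite [_ \in dom]in_set mst andbT !inE c0 -sq /=; apply/eqP/esym.
  exact: splitting_square_slanted.
move=> [[[e c] [[s t] r]]] pd ->.
move: pd; rewrite [_ \in dom]in_set => /andP[lin mst].
have /andP[c0 /eqP sc] : (c != 0) && (is_sqr c == b) by move: lin; rewrite !inE.
have st : s != t by move: mst; rewrite inE => /and5P[].
rewrite in_set -sc splitting_square_slanted // eqxx.
rewrite mem_calD_slanted // c0 mst /=.
by rewrite (inj_eq (mulfI two0)) (inj_eq (addIr _)).
Qed.

(** * Triples on lines of constant linear coefficient *)

(** When u1 = v1, collinearity reads (u0 - v0) (w1 - u1) = 0 up to sign, and
    the resultant of u and v is (u0 - v0)^2. *)
Lemma calD_vertical (F : finFieldType) (u v w : quad_coef F) : odd #|F| ->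
  (u, v, w) \in calD F -> u.2 = v.2 ->
  v.2 = w.2 /\ splitting_square (u, v, w).
Proof.
move=> oddF; rewrite mem_calD //.
move=> /and5P[_ _ _ ruv /and3P[_ _ /eqP d0]] uv.
have resE : res u v = (u.1 - v.1) ^+ 2 by rewrite /res uv; ring.
have uv0 : u.1 - v.1 != 0.
  by apply: contraNneq ruv => uv0; rewrite resE uv0 expr0n.
split; last first.
  rewrite splitting_squareE; apply/existsP; exists (u.1 - v.1).
  by rewrite uv0 resE eqxx.
apply: (mulfI uv0); apply/eqP; rewrite -subr_eq0 -d0 frakdE uv.
by apply/eqP; ring.
Qed.

Definition vertical_triple (F : finFieldType) (p : F * (F * F * F)) :
    quad_triple F :=
  ((p.2.1.1, p.1), (p.2.1.2, p.1), (p.2.2, p.1)).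

Lemma mem_calD_vertical (F : finFieldType) (m a b c : F) : odd #|F| ->
  (vertical_triple (m, (a, b, c)) \in calD F) =
  ((a, b, c) \in distinct_triples [set x | m ^+ 2 - 4 * x != 0]).
Proof.
move=> oddF; rewrite mem_calD // in_set !inE /= /disc /res frakdE /=.
rewrite !subrr !mul0r !mulr0 subrr !addr0 !expf_eq0 /= !subr_eq0 eqxx andbT.
by [].
Qed.

Lemma card_vertical (F : finFieldType) : odd #|F| ->
  #|[set t in calD F | t.1.1.2 == t.1.2.2]| = (#|F| * #|F|.-1 ^_ 3)%N.
Proof.
move=> oddF; have two0 := odd_card_two_neq0 oddF.
pose pts (m : F) := distinct_triples [set x | m ^+ 2 - 4 * x != 0].
have card_pts m : predT m -> #|pts m| = (#|F|.-1 ^_ 3)%N.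
  move=> _; rewrite card_distinct_triples; congr (_ ^_ _)%N.
  rewrite -(cardC1 ((m / 2) ^+ 2)); apply: eq_card => x; rewrite !inE.
  have -> : m ^+ 2 - 4 * x = 2 ^+ 2 * ((m / 2) ^+ 2 - x) by field.
  by rewrite mulf_eq0 expf_eq0 /= (negbTE two0) /= subr_eq0 eq_sym.
pose dom := [set p : F * (F * F * F) | predT p.1 && (p.2 \in pts p.1)].
have <- : #|dom| = (#|F| * #|F|.-1 ^_ 3)%N.
  rewrite (card_dep_pairs card_pts); congr (_ * _)%N.
  by apply: eq_card => m; rewrite inE.
rewrite -(@card_in_imset _ _ (@vertical_triple F) dom); last first.
  by move=> [m [[a b] c]] [m' [[a' b'] c']] _ _ [-> -> -> _ -> _].
apply: eq_card => [[[[u0 u1] [v0 v1]] [w0 w1]]]; apply/idP/imsetP.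
  rewrite [_ \in finset _]in_set => /andP[tD /eqP /= uv].
  have [/= vw _] := calD_vertical oddF tD uv; subst w1 v1.
  exists (u1, (u0, v0, w0)) => //.
  by rewrite [_ \in dom]in_set /= -mem_calD_vertical.
move=> [[m [[a b] c]]] pd ->; move: pd.
rewrite [_ \in dom]in_set /= -mem_calD_vertical // => tD.
by rewrite [_ \in finset _]in_set tD /= eqxx.
Qed.

(** * The two counts *)

Lemma D_nonsquareE (F : finFieldType) : odd #|F| ->
  D_nonsquare F = (#|F| * #|F|./2 * #|F| ^_ 3)%N.
Proof.
move=> oddF; rewrite -[X in (X ^_ 3)%N]subn0 -(card_slanted false oddF).
apply: eq_card => [[[u v] w]]; apply/setIdP/setIdP => -[tD].
  move=> nsq; rewrite eqbF_neg nsq; split=> //=.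
  by apply: contraNneq nsq => /(calD_vertical oddF tD)[].
by rewrite eqbF_neg => /andP[].
Qed.

Lemma D_squareE (F : finFieldType) : odd #|F| ->
  D_square F =
  (#|F| * #|F|./2 * (#|F| - 2) ^_ 3 + #|F| * #|F|.-1 ^_ 3)%N.
Proof.
move=> oddF; rewrite -(card_slanted true oddF) -(card_vertical oddF).
rewrite /D_square -(cardsID [set t : quad_triple F | t.1.1.2 != t.1.2.2]).
congr (_ + _)%N; apply: eq_card => [[[u v] w]].
  rewrite in_setI; apply/andP/setIdP; rewrite in_set eqb_id.
    by case=> /setIdP[tD sq] slant; rewrite sq.
  by case=> tD /andP[sq slant]; split=> //; apply/setIdP.
rewrite in_setD; apply/andP/setIdP; rewrite in_set negbK.
  by case=> vert /setIdP[].
case=> tD vert; split=> //; apply/setIdP; split=> //.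
by case: (calD_vertical oddF tD (eqP vert)).
Qed.

Lemma D_allE (F : finFieldType) : D_all F = (D_square F + D_nonsquare F)%N.
Proof.
rewrite /D_all -(cardsID [set t | splitting_square t]).
by congr (_ + _)%N; apply: eq_card => t; rewrite !in_set // andbC.
Qed.

Lemma odd_card_ge3 (F : finFieldType) : odd #|F| -> (3 <= #|F|)%N.
Proof. by have := finNzRing_gt1 F; case: #|_| => [|[|[|]]]. Qed.

Lemma natr_half_odd (K : numFieldType) (m : nat) : odd m ->
  (m./2)%:R = (m%:R - 1) / 2 :> K.
Proof.
move=> oddm; rewrite -[in RHS](odd_double_half m) oddm -muln2 natrD natrM.
by rewrite (addrC 1) addrK mulfK ?pnatr_eq0.
Qed.

Lemma D_square_rat (F : finFieldType) : odd #|F| ->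
  let q : rat := #|F|%:R in
  (D_square F)%:R = 2^-1 * (q * (q - 1) * (q - 2) ^+ 2 * (q - 3)).
Proof.
move=> oddF q; rewrite D_squareE // natrD !natr_mul_ffact3 natrM.
have q3 := odd_card_ge3 oddF.
rewrite natr_half_odd // -subn1 !natrB ?(leq_trans _ q3) // -/q.
by field.
Qed.

Lemma D_nonsquare_rat (F : finFieldType) : odd #|F| ->
  let q : rat := #|F|%:R in
  (D_nonsquare F)%:R = 2^-1 * (q ^+ 2 * (q - 1) ^+ 2 * (q - 2)).
Proof.
move=> oddF q; rewrite D_nonsquareE // natr_mul_ffact3 natrM.
by rewrite natr_half_odd // -/q; field.
Qed.

Lemma D_all_rat (F : finFieldType) : odd #|F| ->
  let q : rat := #|F|%:R in
  (D_all F)%:R = q * (q - 1) * (q - 2) * (q ^+ 2 - 3 * q + 3).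
Proof.
move=> oddF q; rewrite D_allE natrD D_square_rat // D_nonsquare_rat //.
by rewrite -/q; field.
Qed.

(** * Proportions *)

Lemma D_quadratic_gt0 (R : realFieldType) (q : R) : 0 < q ^+ 2 - 3 * q + 3.
Proof.
have -> : q ^+ 2 - 3 * q + 3 = (q - 3 / 2) ^+ 2 + 3 / 4 by field.
by have := sqr_ge0 (q - 3 / 2); lra.
Qed.

Lemma D_all_neq0 (F : finFieldType) : odd #|F| -> (D_all F)%:R != 0 :> rat.
Proof.
move=> oddF; have := odd_card_ge3 oddF; rewrite -(ler_nat rat) => q3.
rewrite D_all_rat // !mulf_neq0 ?(gt_eqF (D_quadratic_gt0 _)) //.
all: by rewrite gt_eqF //; lra.
Qed.

Lemma nonsquare_ratio (F : finFieldType) : odd #|F| ->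
  let q : rat := #|F|%:R in
  (D_nonsquare F)%:R / (D_all F)%:R =
  (q * (q - 1)) / (2 * (q ^+ 2 - 3 * q + 3)).
Proof.
move=> oddF q; have := odd_card_ge3 oddF; rewrite -(ler_nat rat) -/q => q3.
have Q0 := gt_eqF (D_quadratic_gt0 q).
rewrite D_nonsquare_rat // D_all_rat // -/q; field.
rewrite Q0 !gt_eqF //; lra.
Qed.

Lemma nonsquare_ratio_bound (F : finFieldType) : odd #|F| ->
  `| (D_nonsquare F)%:R / (D_all F)%:R - (2^-1 + #|F|%:R^-1) |
    <= 3 * #|F|%:R ^- 2 :> rat.
Proof.
move=> oddF; set q : rat := #|F|%:R.
have := odd_card_ge3 oddF; rewrite -(ler_nat rat) -/q => q3.
rewrite nonsquare_ratio // -/q; have Qgt0 := D_quadratic_gt0 q.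
have q0 : 0 < q by lra.
have -> : q * (q - 1) / (2 * (q ^+ 2 - 3 * q + 3)) - (2^-1 + q^-1) =
    (3 * q - 6) / (2 * q * (q ^+ 2 - 3 * q + 3)).
  by field; rewrite !gt_eqF.
rewrite ger0_norm; last by rewrite divr_ge0 ?mulr_ge0 //; lra.
rewrite ler_pdivrMr ?mulr_gt0 //.
have -> : 3 * q ^- 2 * (2 * q * (q ^+ 2 - 3 * q + 3)) =
    6 * (q ^+ 2 - 3 * q + 3) / q by field; rewrite gt_eqF.
rewrite ler_pdivlMr //; nra.
Qed.

(** * Stabilisers *)

Lemma quad_inj (F : finFieldType) : injective (@quad F).
Proof.
move=> [a b] [c d] e; have e0 := congr1 (fun p : {poly F} => p`_0) e.
have := congr1 (fun p : {poly F} => p`_1) e.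
by rewrite /= !coef_quad /= => ->; move: e0; rewrite /= !coef_quad /= => ->.
Qed.

Lemma aff_act_quad (F : finFieldType) (a b : F) (u : quad_coef F) : a != 0 ->
  aff_act (a, b) (quad u) =
  quad ((b ^+ 2 + u.2 * b + u.1) / a ^+ 2, (2 * b + u.2) / a).
Proof.
move=> a0; set c0 := _ / a ^+ 2; set c1 := _ / a.
have e0 : b ^+ 2 + u.2 * b + u.1 = a ^+ 2 * c0 by rewrite /c0; field.
have e1 : 2 * b + u.2 = a * c1 by rewrite /c1; field.
have a2 : a ^+ 2 != 0 by rewrite expf_neq0.
apply: (scalerI a2); rewrite /aff_act /= scalerA mulfV // scale1r.
rewrite /quad !comp_polyD comp_polyZ comp_polyC comp_Xn_poly comp_polyX /=.
transitivity ((a ^+ 2)%:P * 'X^2 + a%:P * (2 * b + u.2)%:P * 'X +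
              (b ^+ 2 + u.2 * b + u.1)%:P).
  by rewrite -!mul_polyC !(polyCM, polyCD, polyC_exp); ring.
by rewrite e0 e1 -!mul_polyC !(polyCM, polyC_exp); ring.
Qed.

(** Fixed points of the action, in coordinates, written so that the solutions
    with a = 1 and with a = -1 can be read off. *)
Lemma aff_fixP (F : finFieldType) (a b : F) (u : quad_coef F) : a != 0 ->
  reflect (2 * b = (a - 1) * u.2 /\ b ^+ 2 + u.2 * b = (a ^+ 2 - 1) * u.1)
    (aff_act (a, b) (quad u) == quad u).
Proof.
move=> a0; rewrite aff_act_quad // (inj_eq (@quad_inj F)).
have a2 : a ^+ 2 != 0 by rewrite expf_neq0.
case: u => u0 u1 /=; apply: (iffP eqP) => [[e0 e1]|[e1 e0]].
  move/(canRL (divfK a2)): e0 => e0; move/(canRL (divfK a0)): e1 => e1.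
  split; first by rewrite -[LHS](addrK u1) e1; ring.
  by rewrite -[LHS](addrK u0) e0; ring.
by congr (_, _); rewrite ?e0 ?e1; field.
Qed.

Lemma nontrivial_stabP (F : finFieldType) (u v w : quad_coef F) :
  reflect (exists a b, [/\ a != 0, (a, b) != aff_id F &
             [/\ aff_act (a, b) (quad u) == quad u,
                 aff_act (a, b) (quad v) == quad v &
                 aff_act (a, b) (quad w) == quad w]])
    (nontrivial_stab (u, v, w)).
Proof.
have id_stab : aff_id F \in aff_stab (u, v, w).
  have fix_id (s : quad_coef F) : aff_act (aff_id F) (quad s) == quad s.
    by apply/aff_fixP; rewrite ?oner_eq0 //; split; ring.
  by rewrite /aff_stab !inE oner_eq0 !fix_id.
apply: (iffP idP) => [nt|[a [b [a0 ab [fu fv fw]]]]].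
  have /subsetPn[[a b] st nid] : ~~ (aff_stab (u, v, w) \subset [set aff_id F]).
    by apply: contra nt => sub; rewrite eqEsubset sub sub1set.
  exists a, b; move: st nid; rewrite !inE /= => /andP[a0 /and3P[fu fv fw]] nid.
  by split.
apply: contraNneq ab => stE; rewrite -in_set1 -stE.
by rewrite /aff_stab !inE /= a0 fu fv fw.
Qed.

Lemma nontrivial_stab_slopes (F : finFieldType) (u v w : quad_coef F) :
    odd #|F| ->
  nontrivial_stab (u, v, w) <-> u.2 = v.2 /\ v.2 = w.2.
Proof.
move=> /odd_card_two_neq0 two0; split.
  case/nontrivial_stabP=> a [b [a0 ab []]].
  move=> /(aff_fixP _ _ a0)[eu _] /(aff_fixP _ _ a0)[ev _].
  move=> /(aff_fixP _ _ a0)[ew _].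
  have a1 : a - 1 != 0.
    rewrite subr_eq0; apply: contraNneq ab => a1.
    move/eqP: eu; rewrite a1 subrr mul0r mulf_eq0 (negbTE two0) /= => /eqP ->.
    by rewrite eqxx.
  by split; apply: (mulfI a1); rewrite -?eu -?ev -?ew.
(* The reflection of the line that exchanges the two roots. *)
case=> uv vw; apply/nontrivial_stabP; exists (-1), (- u.2).
have N1 : (-1 : F) != 0 by rewrite oppr_eq0 oner_eq0.
have fix_slope (s : quad_coef F) : s.2 = u.2 ->
    aff_act (-1, - u.2) (quad s) == quad s.
  by move=> su; apply/aff_fixP => //; rewrite su; split; ring.
split=> //; last by split; apply: fix_slope; rewrite ?uv ?vw.
apply: contraNneq two0 => -[e _]; apply/eqP.
by rewrite -[2]/(1 + 1) -{1}e addNr.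
Qed.

Theorem corollary8p3 :
  (forall F : finFieldType, odd #|F| ->
    let q : rat := #|F|%:R in
    let Dsq : rat := (D_square F)%:R in
    let Dnsq : rat := (D_nonsquare F)%:R in
    let D : rat := (D_all F)%:R in
    [/\ Dsq = 2^-1 * (q * (q - 1) * (q - 2) ^+ 2 * (q - 3)),
        Dnsq = 2^-1 * (q ^+ 2 * (q - 1) ^+ 2 * (q - 2)),
        Dsq + Dnsq = D &
        Dnsq / D = (q * (q - 1)) / (2 * (q ^+ 2 - 3 * q + 3))])
  /\
  (exists C : rat, forall F : finFieldType, odd #|F| ->
    let q : rat := #|F|%:R in
    `| (D_nonsquare F)%:R / (D_all F)%:R - (2^-1 + q^-1) | <= C * q ^- 2)
  /\
  (forall eps : rat, 0 < eps ->
    exists N : nat, forall F : finFieldType, odd #|F| -> (N <= #|F|)%N ->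
      `| (D_square F)%:R / (D_all F)%:R - 2^-1 | < eps /\
      `| (D_nonsquare F)%:R / (D_all F)%:R - 2^-1 | < eps)
  /\
  (forall F : finFieldType, odd #|F| ->
    forall u v w : quad_coef F, (u, v, w) \in calD F ->
      (nontrivial_stab (u, v, w) <-> u.2 = v.2 /\ v.2 = w.2) /\
      (nontrivial_stab (u, v, w) -> splitting_square (u, v, w))).
Proof.
split.
  move=> F oddF q Dsq Dnsq D; split.
  - exact: D_square_rat.
  - exact: D_nonsquare_rat.
  - by rewrite /D D_allE natrD.
  - exact: nonsquare_ratio.
split; first by exists 3 => F oddF; exact: nonsquare_ratio_bound.
split; last first.
  move=> F oddF u v w tD; have slopes := nontrivial_stab_slopes u v w oddF.
  split=> // /slopes[uv _].
  by case: (calD_vertical oddF tD uv).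
move=> eps eps0; exists (Num.bound (2 / eps)) => F oddF leNq.
have q3 := odd_card_ge3 oddF; rewrite -(ler_nat rat) in q3.
have := nonsquare_ratio_bound oddF.
set q : rat := #|F|%:R in q3 *; set x := _ / _ => bnd.
have sqE : (D_square F)%:R / (D_all F)%:R - 2^-1 = - (x - 2^-1).
  have := D_all_neq0 oddF; rewrite /x D_allE natrD => D0.
  by field.
rewrite sqE normrN; suff : `|x - 2^-1| < eps by [].
have q_gt : 2 / eps < q.
  apply: lt_le_trans (archi_boundP _) _; last by rewrite ler_nat.
  by rewrite divr_ge0 // ltW.
have q0 : 0 < q by lra.
have : 2 / q < eps by rewrite ltr_pdivrMr // mulrC -ltr_pdivrMr.
apply: le_lt_trans.
have iq0 : 0 <= q^-1 by rewrite invr_ge0 ltW.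
have small : 3 * q ^- 2 <= q^-1.
  have -> : 3 * q ^- 2 = 3 / q * q^-1 by field; rewrite gt_eqF.
  by rewrite ler_piMl // ler_pdivrMr // mul1r.
have := ler_normD (x - (2^-1 + q^-1)) q^-1; rewrite (ger0_norm iq0).
have -> : x - (2^-1 + q^-1) + q^-1 = x - 2^-1 by ring.
by move: bnd small; rewrite /=; lra.
Qed.
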